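(* Let $K$ be a field, and let $I\subset R=K[x_1,\dots,x_n]$ and $J\subset T=K[y_1,\dots,y_m]$ be proper nonzero homogeneous ideals. Let $S=R\otimes_K T=K[x_1,\dots,x_n,y_1,\dots,y_m]$, and denote the extended ideals $IS$ and $JS$ again by $I$ and $J$. Then for all $k\gg0$, $$\mathrm{v}((IJ)^k)\ =\ \min\{\mathrm{v}(I^k)+\alpha(J)k,\ \mathrm{v}(J^k)+\alpha(I)k\}.$$
   Context: Polynomial rings are standard graded. For an ideal $L$ of a polynomial ring $S$, $\operatorname{Ass}(L)$ denotes the set of associated primes of $S/L$. For a proper graded ideal $L$ and $\mathfrak{p}\in\operatorname{Ass}(L)$, $\mathrm{v}_{\mathfrak{p}}(L)$ is the least degree of a homogeneous polynomial $f$ such that $(L:f)=\mathfrak{p}$, and the $\mathrm{v}$-number of $L$ is $\mathrm{v}(L)=\min_{\mathfrak{p}\in\operatorname{Ass}(L)}\mathrm{v}_{\mathfrak{p}}(L)$. For a nonzero graded ideal $L$, $\alpha(L)=\min\{d:(L/\mathfrak{m}L)_d\neq0\}$ is its initial degree, where $\mathfrak{m}$ is the graded maximal ideal; equivalently, the least degree of a nonzero homogeneous element of $L$. ''For all $k\gg0$'' means for all sufficiently large integers $k$. *)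

(* Defs.v *)
From mathcomp Require Import all_boot all_order all_algebra.
From mathcomp Require Import ssrcomplements freeg mpoly.
From Stdlib Require Import ClassicalEpsilon.

Set Implicit Arguments.
Unset Strict Implicit.
Unset Printing Implicit Defensive.

Import GRing.Theory.
Local Open Scope ring_scope.

(* The minimum of a set of natural numbers; unspecified on the empty set. *)
Definition least (A : nat -> Prop) : nat :=
  epsilon (inhabits 0%N) (fun d => A d /\ forall e, A e -> (d <= e)%N).

Lemma leastP (A : nat -> Prop) :
  (exists d, A d) -> A (least A) /\ forall e, A e -> (least A <= e)%N.
Proof.
move=> exA; apply: (epsilon_spec (inhabits 0%N)
  (fun d => A d /\ forall e, A e -> (d <= e)%N)).
case: exA => d; elim/ltn_ind: d => d IHd Ad.
case: (classic (exists2 e, A e & (e < d)%N)) => [[e Ae lt_ed] | noA].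
  exact: IHd lt_ed Ae.
exists d; split=> // e Ae; rewrite leqNgt; apply/negP => lt_ed.
by apply: noA; exists e.
Qed.

(* Ideals are Prop-valued predicates, so that no decidability of membership
   is presupposed; equality of ideals is pointwise equivalence. *)
Section Ideals.
Variable A : comNzRingType.
Implicit Types (L M P X : A -> Prop) (f g : A).

Definition is_ideal L : Prop :=
  [/\ L 0, (forall f g, L f -> L g -> L (f + g))
         & (forall f g, L g -> L (f * g))].

Definition ideal_gen X : A -> Prop :=
  fun f => forall L, is_ideal L -> (forall g, X g -> L g) -> L f.

Definition ideal_mul L M : A -> Prop :=
  ideal_gen (fun h => exists f g, [/\ L f, M g & h = f * g]).

Definition ideal_exp L (k : nat) : A -> Prop :=
  iter k (ideal_mul L) (fun _ => True).

Definition ideal_colon L f : A -> Prop := fun g => L (g * f).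

Definition ideal_eq L M : Prop := forall f, L f <-> M f.

Definition is_proper L : Prop := ~ L 1.

Definition is_nonzero L : Prop := exists2 f, L f & f <> 0.

Definition is_prime P : Prop :=
  [/\ is_ideal P, is_proper P
    & forall f g, P (f * g) -> P f \/ P g].

(* P is the annihilator of the class of some f in A / L *)
Definition associated_prime L P : Prop :=
  is_prime P /\ exists f, ideal_eq (ideal_colon L f) P.

End Ideals.

Definition ideal_ext (A B : comNzRingType) (phi : A -> B) (L : A -> Prop) :
    B -> Prop :=
  ideal_gen (fun g => exists2 f, L f & g = phi f).

Section Graded.
Variables (K : fieldType) (n : nat).
Implicit Types (L P : {mpoly K[n]} -> Prop) (f : {mpoly K[n]}).

Definition is_homogeneous L : Prop :=
  is_ideal L /\ forall f d, L f -> L (pihomog mdeg d f).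

Definition graded_maximal_ideal : {mpoly K[n]} -> Prop :=
  ideal_gen (fun f => exists i : 'I_n, f = 'X_i).

(* [f \is d.-homog] also holds for f = 0, but (L : 0) is the unit ideal,
   hence never a prime P. *)
Definition vnum_at L P : nat :=
  least (fun d => exists2 f, f \is d.-homog & ideal_eq (ideal_colon L f) P).

Definition vnum L : nat :=
  least (fun d => exists2 P, associated_prime L P & d = vnum_at L P).

(* (L / mL)_d is nonzero iff some element of L_d lies outside mL *)
Definition initial_degree L : nat :=
  least (fun d => exists f,
    [/\ f \is d.-homog, L f & ~ ideal_mul graded_maximal_ideal L f]).

End Graded.

Definition inclx (K : fieldType) (n m : nat) (p : {mpoly K[n]}) :
    {mpoly K[n + m]} :=
  p \mPo [tuple 'X_(lshift m i) | i < n].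

Definition incly (K : fieldType) (n m : nat) (p : {mpoly K[m]}) :
    {mpoly K[n + m]} :=
  p \mPo [tuple 'X_(rshift n j) | j < m].

(* Main.v *)
Require Import Defs.
From HB Require Import structures.
From mathcomp Require Import all_boot all_order all_algebra.
From mathcomp Require Import ssrcomplements freeg mpoly.
From mathcomp Require Import zify.
From Stdlib Require Import ClassicalEpsilon.

(* Write A = I^k and B = J^k.  Since the variables are disjoint,
   (IJ)^k = AB = A S \cap B S.  If (AB : f) = P is prime then, P being the
   intersection of (A S : f) and (B S : f), it equals one of them, say
   (A S : f); then A f lies in B S, and a nonzero element of R is regular modulo
   B S, so f lies in B S and all its terms have y-degree at least alpha(B).
   The contraction of P to R is a finite intersection of colons (A : f_b) by the
   coefficients f_b of f, hence one of these, so
   deg f >= v(A) + alpha(B).  Conversely, if (A : f) is prime in R and t in B is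
   nonzero of least degree, then (AB : f t) = (A : f) S is prime.  Finally
   alpha(J^k) = k alpha(J).  The identity thus holds for every k >= 1. *)

Set Implicit Arguments.
Unset Strict Implicit.
Unset Printing Implicit Defensive.

(** * Ideals of a commutative ring *)

Section IdealTheory.
Import GRing.Theory.
Local Open Scope ring_scope.
Variable A : comNzRingType.
Implicit Types (L M N P X : A -> Prop) (f g h : A).

Lemma ideal_mulr L f g : is_ideal L -> L f -> L (f * g).
Proof. by case=> _ _ LM Lf; rewrite mulrC; apply: LM. Qed.

Lemma ideal_sub L f g : is_ideal L -> L f -> L g -> L (f - g).
Proof. by case=> _ LD LM Lf Lg; apply: LD => //; rewrite -mulN1r; apply: LM. Qed.

Lemma ideal_sum L (T : eqType) (r : seq T) (C : pred T) (F : T -> A) :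
  is_ideal L -> (forall x, x \in r -> C x -> L (F x)) ->
  L (\sum_(x <- r | C x) F x).
Proof.
case=> L0 LD _ LF; rewrite big_seq_cond; elim/big_ind: _ => // x.
by case/andP; apply: LF.
Qed.

Lemma ideal_gen_ideal X : is_ideal (ideal_gen X).
Proof.
split=> [L [L0 _ _] _ // | f g Xf Xg L Li XL | f g Xg L Li XL].
- by case: (Li) => _ LD _; apply: LD; [apply: Xf | apply: Xg].
- by case: (Li) => _ _ LM; apply: LM; apply: Xg.
Qed.

Lemma ideal_mul_ideal L M : is_ideal (ideal_mul L M).
Proof. exact: ideal_gen_ideal. Qed.

Lemma ideal_mul_mem L M f g : L f -> M g -> ideal_mul L M (f * g).
Proof. by move=> Lf Mg N _; apply; exists f, g. Qed.

Lemma ideal_mul_min L M N h :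
  is_ideal N -> (forall f g, L f -> M g -> N (f * g)) ->
  ideal_mul L M h -> N h.
Proof. by move=> Ni LMN; apply=> // _ [f [g [Lf Mg ->]]]; apply: LMN. Qed.

Lemma ideal_exp_ideal L k : is_ideal (ideal_exp L k).
Proof. by case: k => [|k]; [split | apply: ideal_mul_ideal]. Qed.

Lemma ideal_colon_ideal L f : is_ideal L -> is_ideal (ideal_colon L f).
Proof.
rewrite /ideal_colon; case=> L0 LD LM; split=> [|g h Lg Lh|g h Lh].
- by rewrite mul0r.
- by rewrite mulrDl; apply: LD.
- by rewrite -mulrA; apply: LM.
Qed.

(** Positive powers of L lie in L, whereas the zeroth power is the whole ring. *)
Lemma ideal_exp_proper L k : is_ideal L -> is_proper L -> (0 < k)%N ->
  is_proper (ideal_exp L k).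
Proof.
move=> Li L1; case: k => // k _ Lk; apply: L1.
by apply: ideal_mul_min Lk => // f g Lf _; apply: ideal_mulr.
Qed.

Lemma ideal_exp_pow L f k : L f -> ideal_exp L k (f ^+ k).
Proof. by move=> Lf; elim: k => // k IHk; rewrite exprS; apply: ideal_mul_mem. Qed.

Lemma is_prime_eq P Q : ideal_eq P Q -> is_prime P -> is_prime Q.
Proof.
move=> PQ [[P0 PD PM] P1 Pp]; split; first split.
- exact/PQ.
- by move=> f g /PQ Pf /PQ Pg; apply/PQ; apply: PD.
- by move=> f g /PQ Pg; apply/PQ; apply: PM.
- by move/PQ.
- by move=> f g /PQ /Pp [] /PQ; [left | right].
Qed.

(** If some g0 in [Q x] lies outside P, multiplying by g0 shows that P contains the intersection of
    the remaining ideals. Properness of P excludes the empty intersection. *)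
Lemma prime_bigcap (T : eqType) P (s : seq T) (Q : T -> A -> Prop) :
  is_prime P -> (forall x, is_ideal (Q x)) ->
  (forall g, (forall x, x \in s -> Q x g) -> P g) ->
  exists2 x, x \in s & forall g, Q x g -> P g.
Proof.
case=> Pi P1 Pp Qi; elim: s => [|x s IHs] QP; first by case: P1; apply: QP.
case: (classic (exists2 g, Q x g & ~ P g)) => [[g0 Qg0 nPg0] | noQ]; last first.
  exists x; rewrite ?mem_head // => g Qg; apply: NNPP => nPg.
  by apply: noQ; exists g.
case: IHs => [g Qg | y ys QyP]; last by exists y; rewrite // inE ys orbT.
have /Pp[] // : P (g0 * g).
apply: QP => y; rewrite inE => /predU1P [-> | ys]; first exact: ideal_mulr.
by case: (Qi y) => _ _; apply; apply: Qg.
Qed.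

End IdealTheory.

(** * Noetherianity of polynomial rings *)

Section Noetherian.
Import Order.TTheory GRing.Theory.
Local Open Scope ring_scope.

(** Each chosen index minimises u on the tail starting just after the previous choice, and all later
    choices lie in that tail. *)
Lemma nondecreasing_subsequence (u : nat -> nat) :
  exists2 g : nat -> nat, {homo g : i j / (i < j)%N} &
    {homo u \o g : i j / (i <= j)%N}.
Proof.
have argmin N : exists i, (N <= i)%N /\ forall j, (N <= j)%N -> (u i <= u j)%N.
  have [[i Ni ui] min] := @leastP (fun d => exists2 i, (N <= i)%N & d = u i)
    (ex_intro _ (u N) (ex_intro2 _ _ N (leqnn N) erefl)).
  by exists i; split=> // j Nj; rewrite -ui; apply: min; exists j.
pose a N := proj1_sig (constructive_indefinite_description _ (argmin N)).
have aP N : (N <= a N)%N /\ forall j, (N <= j)%N -> (u (a N) <= u j)%N.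
  exact: proj2_sig (constructive_indefinite_description _ (argmin N)).
pose g := fix g k := if k is k'.+1 then a (g k').+1 else a 0%N.
have gS k : (g k < g k.+1)%N by case: (aP (g k).+1).
have gmin k j : (g k <= j)%N -> (u (g k) <= u j)%N.
  case: k => [|k] gj; first by case: (aP 0%N) => _; apply.
  by case: (aP (g k).+1) => _; apply; apply: leq_trans (gS k) gj.
have gmono : {homo g : i j / (i < j)%N}.
  by apply: homo_ltn => //; apply: ltn_trans.
exists g => // i j; rewrite leq_eqVlt => /predU1P [-> // | lt_ij].
by apply: gmin; apply: ltnW; apply: gmono.
Qed.

(** Dickson's lemma: refine the sequence for one coordinate at a time; a further subsequence keeps
    the earlier coordinates monotone. *)
Lemma dickson n (w : nat -> 'X_{1..n}) :
  exists i j, (i < j)%N /\ (w i <= w j)%MM.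
Proof.
have [g g_mono wg] : exists2 g : nat -> nat, {homo g : i j / (i < j)%N} &
    forall c, c \in enum 'I_n -> {homo (fun i => w (g i) c) : i j / (i <= j)%N}.
  elim: (enum 'I_n) => [|c s [g g_mono wg]]; first by exists id.
  have [h h_mono wh] := nondecreasing_subsequence (fun i => w (g i) c).
  exists (g \o h) => [i j lt_ij | d]; first by apply/g_mono/h_mono.
  rewrite inE => /predU1P [-> // | ds] i j le_ij; apply: wg => //.
  exact: ltnW_homo.
exists (g 0%N), (g 1%N); split; first exact: g_mono.
by apply/mnm_lepP => c; apply: (wg c) => //; rewrite mem_enum.
Qed.

Variables (K : fieldType) (n : nat).
Implicit Types (L : {mpoly K[n]} -> Prop) (f g : {mpoly K[n]}).

(** In a strict chain pick [x k] in [C k.+1] outside [C k] with least leading monomial. By Dickson's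
    lemma some lead of [x i] divides that of [x j] with i < j, and cancelling leading terms
    contradicts minimality at j. *)
Lemma ideal_acc (C : nat -> {mpoly K[n]} -> Prop) :
  (forall k, is_ideal (C k)) -> (forall k f, C k f -> C k.+1 f) ->
  ~ forall k, exists2 f, C k.+1 f & ~ C k f.
Proof.
move=> Ci CS strict.
have minx k : exists f, [/\ C k.+1 f, ~ C k f &
    forall g, C k.+1 g -> (mlead g < mlead f)%O -> C k g].
  have [f] := strict k; move mf: (mlead f) => mo.
  elim/(@ltmwf n): mo f mf => mo IH f mf Cf nCf.
  case: (classic (exists g, [/\ C k.+1 g, (mlead g < mo)%O & ~ C k g])).
    by case=> g [Cg lt_g nCg]; apply: IH lt_g g erefl Cg nCg.
  move=> noG; exists f; split=> // g Cg; rewrite mf => lt_g.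
  by apply: NNPP => nCg; apply: noG; exists g.
pose x k := proj1_sig (constructive_indefinite_description _ (minx k)).
have xP k : [/\ C k.+1 (x k), ~ C k (x k) &
    forall g, C k.+1 g -> (mlead g < mlead (x k))%O -> C k g].
  exact: proj2_sig (constructive_indefinite_description _ (minx k)).
have Cle i j f : (i <= j)%N -> C i f -> C j f.
  by move=> /subnK <-; elim: (j - i)%N => // d IH /IH; apply: CS.
have [i [j [lt_ij le_ij]]] := dickson (fun k => mlead (x k)).
have [Cxi nCxi _] := xP i; have [Cxj nCxj minj] := xP j.
have [C0 CD CM] := Ci j.
have xi0 : x i != 0 by apply/eqP => x0; apply: nCxi; rewrite x0; case: (Ci i).
have xj0 : x j != 0 by apply/eqP => x0; apply: nCxj; rewrite x0.
set b := (mlead (x j) - mlead (x i))%MM.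
have bE : (mlead (x i) + b)%MM = mlead (x j) by rewrite addmC submK.
(* With this scalar, h is a multiple of [x i], hence in [C j], with the same leading term as
   [x j]. *)
pose c := mleadc (x j) / mleadc (x i).
pose h := (c *: 'X_[b]) * x i.
have c0 : c != 0 by rewrite mulf_neq0 ?invr_eq0 ?mleadc_eq0.
have cX0 : c *: 'X_[b] != 0 :> {mpoly K[n]}.
  by rewrite -mleadc_eq0 mleadZ // mleadXm mcoeffZ mcoeffX eqxx mulr1.
have Ch : C j h by apply: CM; apply: Cle Cxi.
have mh : mlead h = mlead (x j).
  by rewrite mleadM // mleadZ // mleadXm addmC bE.
have hc : mleadc h = mleadc (x j).
  rewrite /h mleadM // mleadcM mleadZ // mleadXm mcoeffZ mcoeffX eqxx mulr1.
  by rewrite /c divfK ?mleadc_eq0.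
apply: nCxj; rewrite -[x j](subrK h); apply: CD => //.
case: (eqVneq (x j - h) 0) => [-> // | d0].
apply: minj; first by apply: ideal_sub => //; apply: CS.
have le_d : (mlead (x j - h) <= mlead (x j))%O.
  by apply: le_trans (mleadB_le _ _) _; rewrite mh joinxx.
rewrite lt_neqAle le_d andbT; apply/eqP => Ed.
by move: d0; rewrite -mleadc_eq0 Ed mcoeffB -{2}mh hc subrr eqxx.
Qed.

(** If (L : f) is proper but not prime, say gh lies in it but g and h do not, then (L : gf) is
    proper and strictly larger, as it also contains h. Iterating from f = 1 contradicts the chain
    condition. *)
Lemma prime_colon_exists L :
  is_ideal L -> is_proper L -> exists f, is_prime (ideal_colon L f).
Proof.
move=> Li L1; apply: NNPP => noprime.
(* The condition on f stands under the existential so that choice yields a total function. *)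
have step f : exists g, ~ L f ->
    [/\ ~ L (g * f) & exists2 h, ideal_colon L (g * f) h & ~ ideal_colon L f h].
  case: (classic (exists g, ~ L f -> [/\ ~ L (g * f) &
    exists2 h, ideal_colon L (g * f) h & ~ ideal_colon L f h])) => // nog.
  case: noprime; exists f; split; first exact: ideal_colon_ideal.
    rewrite /is_proper /ideal_colon mul1r => Lf.
    by apply: nog; exists 0 => /(_ Lf).
  move=> g h gh; apply: NNPP => /not_or_and [ng nh].
  apply: nog; exists g => _; split=> //; exists h => //.
  by rewrite /ideal_colon mulrA [h * g]mulrC.
pose s f := proj1_sig (constructive_indefinite_description _ (step f)).
have sP f : ~ L f -> [/\ ~ L (s f * f) &
    exists2 h, ideal_colon L (s f * f) h & ~ ideal_colon L f h].
  exact: proj2_sig (constructive_indefinite_description _ (step f)).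
pose F k := iter k (fun f => s f * f) 1.
have FP k : ~ L (F k) by elim: k => [|k /sP []].
apply: (@ideal_acc (fun k => ideal_colon L (F k))) => [k | k f | k].
- exact: ideal_colon_ideal.
- rewrite /ideal_colon /= mulrCA; by case: Li => _ _; apply.
- by have [_] := sP _ (FP k).
Qed.

End Noetherian.

(** * Graded ideals and their v-numbers *)

Section GradedTheory.
Import GRing.Theory.
Local Open Scope ring_scope.
Variables (K : fieldType) (n : nat).
Implicit Types (L M P : {mpoly K[n]} -> Prop) (f g h : {mpoly K[n]}).

Local Notation pi d f := (pihomog mdeg d f).

Lemma pihomog_sumE k f : (msize f <= k)%N -> \sum_(d < k) pi d f = f.
Proof. by move=> le_k; rewrite -pihomog_partitionE. Qed.

Lemma pihomog_if d e f : f \is e.-homog -> pi d f = if e == d then f else 0.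
Proof.
by case: eqP => [-> | /eqP ne] fe; [apply: pihomog_dE | apply: pihomog_ne0 fe].
Qed.

Lemma mcoeff_pihomog d f m : (pi d f)@_m = if mdeg m == d then f@_m else 0.
Proof.
case: eqP => [md | /eqP md]; last exact: dhomog_nemf_coeff (pihomogP _ _ _) md.
(* The bound exceeds d so that d is a summation index even when it is at least [msize f]. *)
have dk : (d < maxn (msize f) d.+1)%N by rewrite leq_max ltnSn orbT.
rewrite -{2}(pihomog_sumE (leq_maxl (msize f) d.+1)) [in RHS]raddf_sum /=.
rewrite (bigD1 (Ordinal dk)) //= big1 ?addr0 // => i ne_i.
apply: dhomog_nemf_coeff (pihomogP _ _ _) _; rewrite /= md eq_sym.
by apply: contra ne_i => /eqP id; apply/eqP/val_inj.
Qed.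

Lemma pihomogMl c e h f : h \is e.-homog ->
  pi c (h * f) = if (e <= c)%N then h * pi (c - e) f else 0.
Proof.
move=> he; set k := maxn (msize f) c.+1.
have piM (j : nat) : pi c (h * pi j f) = if (e + j)%N == c then h * pi j f else 0.
  exact/pihomog_if/dhomogM/pihomogP.
rewrite -{1}(pihomog_sumE (leq_maxl (msize f) c.+1)) mulr_sumr raddf_sum /=.
case: leqP => [le_ec | lt_ce]; last first.
  by rewrite big1 // => j _; rewrite piM gtn_eqF // ltn_addr.
have dk : (c - e < k)%N by rewrite leq_max ltnS leq_subr orbT.
rewrite (bigD1 (Ordinal dk)) //= piM /= subnKC // eqxx big1 ?addr0 // => j ne_j.
rewrite piM; case: eqP => // Ec; case/eqP: ne_j; apply: val_inj => /=.
by rewrite -Ec addKn.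
Qed.

Lemma pihomogM c k f g : (msize f <= k)%N ->
  pi c (f * g) = \sum_(i < k) if (i <= c)%N then pi i f * pi (c - i) g else 0.
Proof.
move=> le_k; rewrite -{1}(pihomog_sumE le_k) mulr_suml raddf_sum /=.
by apply: eq_bigr => i _; apply/pihomogMl/pihomogP.
Qed.

(** The polynomials whose components all lie in the product form an ideal containing its
    generators. *)
Lemma homogeneous_mul L M :
  is_homogeneous L -> is_homogeneous M -> is_homogeneous (ideal_mul L M).
Proof.
move=> [Li Lh] [Mi Mh]; have LMi : is_ideal (ideal_mul L M) by apply: ideal_mul_ideal.
split=> // f d LMf; move: f LMf d.
have mulh g f d : (forall e, ideal_mul L M (pi e f)) -> ideal_mul L M (pi d (g * f)).
  move=> fh; rewrite (pihomogM _ _ (leqnn _)); apply: ideal_sum => // i _ _.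
  by case: ifP => _; [case: LMi => _ _; apply | case: LMi].
move=> f; apply: (ideal_mul_min
  (N := fun g => forall d, ideal_mul L M (pi d g))) => [|g h Lg Mh' d].
  split=> [d | g h gh hh d | g h hh d]; first by rewrite pihomog0; case: LMi.
    by rewrite pihomogD; case: LMi => _ LMD _; apply: LMD.
  exact: mulh.
rewrite (pihomogM _ _ (leqnn _)); apply: ideal_sum => // i _ _.
case: ifP => _; last by case: LMi.
by apply: ideal_mul_mem; [apply: Lh | apply: Mh].
Qed.

Lemma homogeneous_exp L k : is_homogeneous L -> is_homogeneous (ideal_exp L k).
Proof.
move=> Lh; elim: k => [|k IHk]; first by split; [split | ].
exact: homogeneous_mul.
Qed.

(* If some homogeneous h outside (L : f) kills the lowest component f_r modulo
   L, then f may be replaced by h (f - f_r), which has fewer components and the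
   same colon; otherwise comparing components gives (L : f) = (L : f_r). *)
Lemma prime_colon_homog L f : is_homogeneous L -> is_prime (ideal_colon L f) ->
  exists d f', f' \is d.-homog /\ ideal_eq (ideal_colon L f') (ideal_colon L f).
Proof.
move=> Lh; have [Li Lpi] := Lh; have [L0 LD LM] := Li.
(* Induction on the length l of a window of degrees, starting at r, outside which f has no
   component. *)
suff main l r : (forall i, ~~ (r <= i < r + l)%N -> pi i f = 0) ->
    is_prime (ideal_colon L f) ->
    exists d f', f' \is d.-homog /\ ideal_eq (ideal_colon L f') (ideal_colon L f).
  apply: (main (msize f) 0%N) => i; rewrite add0n /= -leqNgt => le_i.
  apply/mpolyP => m; rewrite mcoeff_pihomog mcoeff0; case: eqP => // mi.
  by apply: memN_msupp_eq0; apply: msize_mdeg_ge; rewrite mi.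
elim: l r f => [|l IHl] r {}f f_supp fP.
  case: fP => _ P1 _; case: P1; rewrite /ideal_colon mul1r.
  have -> // : f = 0.
  rewrite -(pihomog_sumE (leqnn (msize f))) big1 // => i _; apply: f_supp.
  by lia.
case: (classic (exists s h, [/\ h \is s.-homog, ~ ideal_colon L f h & L (h * pi r f)])).
  case=> s [h [hs hnP Lhr]].
  (* Since h kills f_r modulo L, whatever kills h (f - f_r) also kills h f; primality then cancels
     h. *)
  have eqP' : ideal_eq (ideal_colon L (h * (f - pi r f))) (ideal_colon L f).
    move=> g; rewrite /ideal_colon mulrBr mulrBr; split=> Lg.
      have [_ _ fp] := fP; have [] // := fp g h.
      rewrite /ideal_colon -mulrA -[X in L X](subrK (g * (h * pi r f))).
      by apply: LD => //; apply: LM.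
    by apply: ideal_sub => //; [rewrite mulrCA; apply: LM | apply: LM].
  have [||d [f' [f'd f'P]]] := IHl (r.+1 + s)%N (h * (f - pi r f)).
  - move=> i ni; rewrite (pihomogMl _ _ hs); case: leqP => // le_si.
    rewrite raddfB /= (pihomog_if _ (pihomogP _ _ _)).
    case: eqP => [<-|ne]; first by rewrite subrr mulr0.
    rewrite subr0 f_supp ?mulr0 //; apply: contra ni => /andP[]; lia.
  - by apply: is_prime_eq fP => g; split=> /eqP'.
  - by exists d, f'; split=> // g; split=> [/f'P /eqP' | /eqP' /f'P].
move=> noh; exists r, (pi r f); split; first exact: pihomogP.
have {}noh s h : h \is s.-homog -> L (h * pi r f) -> ideal_colon L f h.
  by move=> hs Lhr; apply: NNPP => nP; apply: noh; exists s, h.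
move=> g; split=> [Lg | Pg].
  rewrite -(pihomog_sumE (leqnn (msize g))).
  apply: ideal_sum; first exact: ideal_colon_ideal.
  move=> s _ _; apply: noh (pihomogP _ _ _) _.
  have := Lpi _ (s + r)%N Lg; rewrite mulrC (pihomogMl _ _ (pihomogP _ _ _)).
  by rewrite leq_addl addnK mulrC.
suff Lg s : L (pi s g * pi r f).
  rewrite /ideal_colon -(pihomog_sumE (leqnn (msize g))) mulr_suml.
  exact: ideal_sum.
(* In degree s + r of g f, the terms g_i f_(s+r-i) with i < s lie in L by induction and [noh], and
   those with i > s vanish because f has no component below r. *)
elim/ltn_ind: s => s IHs.
have := Lpi _ (s + r)%N Pg; rewrite (pihomogM _ _ (leq_maxl (msize g) s.+1)).
have sk : (s < maxn (msize g) s.+1)%N by rewrite leq_max ltnSn orbT.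
rewrite (bigD1 (Ordinal sk)) //= leq_addr addKn => Lsum.
rewrite -[X in L X](addrK (\sum_(i < maxn (msize g) s.+1 | i != Ordinal sk)
  if (i <= s + r)%N then pi i g * pi (s + r - i) f else 0)).
apply: ideal_sub => //; apply: ideal_sum => // i _ ne_i.
case: leqP => // le_i; case: (ltngtP i s) => [lt_is | lt_si | eq_is].
- have /(Lpi _ (s + r)%N) := noh _ _ (pihomogP _ _ _) (IHs i lt_is).
  by rewrite (pihomogMl _ _ (pihomogP _ _ _)) le_i.
- by rewrite f_supp ?mulr0 //; lia.
- by case/eqP: ne_i; apply: val_inj.
Qed.

(** * The v-number as a single minimum over prime colons *)

Definition prime_colon_degree L d : Prop :=
  exists2 f, f \is d.-homog & is_prime (ideal_colon L f).

(** A prime of the form (L : f) is associated, so the two nested minima merge into one. As [least]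
    is unspecified on the empty set, both sets must be shown nonempty: the outer one by
    noetherianity, the inner ones by homogeneous witnesses. *)
Lemma vnumP L : is_homogeneous L -> is_proper L ->
  prime_colon_degree L (vnum L) /\
  forall d, prime_colon_degree L d -> (vnum L <= d)%N.
Proof.
move=> Lh L1; have [Li _] := Lh.
have vatP P : associated_prime L P -> prime_colon_degree L (vnum_at L P) /\
    forall f d, f \is d.-homog -> ideal_eq (ideal_colon L f) P ->
      (vnum_at L P <= d)%N.
  case=> Pp [f fP].
  have fpr : is_prime (ideal_colon L f) by apply: is_prime_eq Pp => g; split=> /fP.
  have [d [f' [f'd f'P]]] := prime_colon_homog Lh fpr.
  have [|[h hd hP] min] := @leastP (fun d => exists2 f, f \is d.-homog &
    ideal_eq (ideal_colon L f) P).
    by exists d, f' => // g; split=> [/f'P /fP | /fP /f'P].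
  split; first by exists h => //; apply: is_prime_eq Pp => g; split=> /hP.
  by move=> g e ge gP; apply: min; exists g.
have [f fpr] := prime_colon_exists Li L1.
have [|[P Pass vE] min] := @leastP (fun d => exists2 P, associated_prime L P &
  d = vnum_at L P).
  exists (vnum_at L (ideal_colon L f)), (ideal_colon L f) => //.
  by split=> //; exists f.
split; first by rewrite /vnum vE; case: (vatP _ Pass).
move=> d [g gd gpr].
have gass : associated_prime L (ideal_colon L g) by split=> //; exists g.
apply: leq_trans (min _ _) _; first by exists (ideal_colon L g).
by case: (vatP _ gass) => _; apply; [exact: gd |].
Qed.

(** * Initial degrees and their behaviour under powers *)

Definition degree_ge d f : Prop := forall m, m \in msupp f -> (d <= mdeg m)%N.

Lemma degree_geM d e f g : degree_ge d f -> degree_ge e g -> degree_ge (d + e) (f * g).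
Proof.
move=> fd ge m /msuppM_le /allpairsP[[m1 m2] /= [m1f m2g ->]].
by rewrite mdegD leq_add ?fd ?ge.
Qed.

Lemma degree_ge_ideal d : is_ideal (degree_ge d).
Proof.
split=> [m | f g fd gd m | f g gd]; first by rewrite msupp0.
  by move/msuppD_le; rewrite mem_cat => /orP[/fd | /gd].
by rewrite -[d]add0n; apply: degree_geM.
Qed.

(** Bounding all terms of all elements, not just homogeneous elements, gives a condition that passes
    to products. *)
Definition min_degree L d : Prop :=
  (exists f, [/\ f \is d.-homog, L f & f <> 0]) /\ forall f, L f -> degree_ge d f.

(** If d is the least degree of a nonzero form in L, the terms of elements of mL have degree above
    d, so a form of degree d in L lies outside mL. Conversely, a form outside mL is nonzero. *)
Lemma min_degree_initial L : is_homogeneous L -> is_nonzero L ->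
  min_degree L (initial_degree L).
Proof.
move=> [Li Lh] [f0 Lf0 f00].
have comp f m : m \in msupp f -> pi (mdeg m) f <> 0.
  rewrite mcoeff_msupp => /eqP fm p0; apply: fm.
  by have := mcoeff_pihomog (mdeg m) f m; rewrite p0 eqxx mcoeff0.
have [|[f [fd Lf f_neq0]] amin] :=
    @leastP (fun d => exists f, [/\ f \is d.-homog, L f & f <> 0]).
  exists (mdeg (mlead f0)), (pi (mdeg (mlead f0)) f0); split.
  - exact: pihomogP.
  - exact: Lh.
  - by apply/comp/mlead_supp/eqP.
move: (least _) => d in fd amin.
have La g : L g -> degree_ge d g.
  move=> Lg m mg; apply: amin; exists (pi (mdeg m) g).
  by split; [apply: pihomogP | apply: Lh | apply: comp].
have mL g : ideal_mul (@graded_maximal_ideal K n) L g -> degree_ge d.+1 g.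
  apply: ideal_mul_min; first exact: degree_ge_ideal.
  move=> u v mu Lv; rewrite -add1n; apply: degree_geM (La v Lv).
  apply: mu; first exact: degree_ge_ideal.
  by move=> _ [i ->] m /mem_msuppXP <-; rewrite mdeg1.
have nmf : ~ ideal_mul (@graded_maximal_ideal K n) L f.
  have lead_f : mlead f \in msupp f by apply/mlead_supp/eqP.
  by move/mL/(_ _ lead_f); rewrite (dhomogP _ _ _ fd) // ltnn.
have [|[g [gd Lg nmg]] dmin] := @leastP (fun d => exists g,
    [/\ g \is d.-homog, L g & ~ ideal_mul (@graded_maximal_ideal K n) L g]).
  by exists d, f.
have g0 : g <> 0.
  move=> g0; apply: nmg; rewrite g0.
  by case: (ideal_mul_ideal (@graded_maximal_ideal K n) L).
have da : initial_degree L = d.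
  apply/eqP; rewrite eqn_leq; apply/andP; split.
    by apply: dmin; exists f.
  by apply: amin; exists g.
by rewrite da; split=> //; exists f.
Qed.

(** The power f^k of a nonzero form f of degree d attains the bound, as polynomial rings are
    domains. *)
Lemma min_degree_exp L d k : min_degree L d -> min_degree (ideal_exp L k) (d * k).
Proof.
case=> [[f [fd Lf f0]] La]; split.
  exists (f ^+ k); split; [exact: dhomogMn | exact: ideal_exp_pow |].
  by move/eqP; rewrite expf_eq0 => /andP[_ /eqP].
elim: k => [|k IHk] g; first by rewrite muln0.
rewrite mulnS; apply: ideal_mul_min; first exact: degree_ge_ideal.
by move=> u v Lu Lv; apply: degree_geM; [apply: La | apply: IHk].
Qed.

End GradedTheory.

(** * Extension of ideals to more variables *)

(* A partition of the N variables into two blocks: [phi] and [psi] embed the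
   polynomial rings in each block, and every monomial factors uniquely.  The
   two blocks play symmetric roles, see [swap]. *)
Record splitting (K : fieldType) (n m N : nat) := Splitting {
  pairm : 'X_{1..n} -> 'X_{1..m} -> 'X_{1..N};
  fstm : 'X_{1..N} -> 'X_{1..n};
  sndm : 'X_{1..N} -> 'X_{1..m};
  pairmK : forall w, pairm (fstm w) (sndm w) = w;
  fstmK : forall a b, fstm (pairm a b) = a;
  sndmK : forall a b, sndm (pairm a b) = b;
  mdeg_pairm : forall a b, mdeg (pairm a b) = (mdeg a + mdeg b)%N;
  phi : {lrmorphism {mpoly K[n]} -> {mpoly K[N]}};
  psi : {lrmorphism {mpoly K[m]} -> {mpoly K[N]}};
  phi_psiX : forall a b, (phi 'X_[a] * psi 'X_[b])%R = 'X_[pairm a b]%R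
}.

Definition swap K n m N (s : splitting K n m N) : splitting K m n N :=
  @Splitting K m n N (fun b a => pairm s a b) (sndm s) (fstm s) (pairmK s)
    (fun b a => sndmK s a b) (fun b a => fstmK s a b)
    (fun b a => etrans (mdeg_pairm s a b) (addnC _ _)) (psi s) (phi s)
    (fun b a => etrans (GRing.mulrC _ _) (phi_psiX s a b)).

Section Splitting.
Import Order.TTheory GRing.Theory.
Local Open Scope ring_scope.
Variables (K : fieldType) (n m N : nat) (s : splitting K n m N).
Local Notation phi := (phi s).
Local Notation psi := (psi s).
Local Notation R := {mpoly K[n]}.
Local Notation T := {mpoly K[m]}.
Local Notation S := {mpoly K[N]}.
Implicit Types (f g h : S) (A B : R -> Prop).

(** The coefficient at the monomial b when f is read as a polynomial in the second block over R. *)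
Definition coefl (b : 'X_{1..m}) f : R :=
  \sum_(w <- msupp f | sndm s w == b) f@_w *: 'X_[fstm s w].

Lemma pairm_eq w a b : (w == pairm s a b) = (fstm s w == a) && (sndm s w == b).
Proof.
apply/eqP/andP => [-> | [/eqP <- /eqP <-]]; last by rewrite pairmK.
by rewrite fstmK sndmK !eqxx.
Qed.

Lemma mcoeff_coefl b f a : (coefl b f)@_a = f@_(pairm s a b).
Proof.
rewrite {2}(mpolyE f) /coefl big_mkcond !raddf_sum /=; apply: eq_bigr => w _.
rewrite mcoeffZ mcoeffX pairm_eq andbC.
by case: (sndm s w == b); rewrite ?mcoeffZ ?mcoeffX ?mcoeff0 ?mulr0.
Qed.

Lemma coefl_is_linear b : linear (coefl b).
Proof.
move=> c f g; apply/mpolyP => a.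
by rewrite mcoeffD mcoeffZ !mcoeff_coefl mcoeffD mcoeffZ.
Qed.

HB.instance Definition _ b :=
  GRing.isLinear.Build K S R _ (coefl b) (coefl_is_linear b).

Lemma coefl_phi_psi b a t : coefl b (phi a * psi t) = t@_b *: a.
Proof.
apply/mpolyP => c; rewrite mcoeff_coefl mcoeffZ [RHS]mulrC.
rewrite {1}(mpolyE a) {1}(mpolyE t) !linear_sum /= big_distrlr /=.
rewrite {3}(mpolyE a) {3}(mpolyE t) !raddf_sum /= big_distrlr /=.
apply: eq_bigr => u _; rewrite raddf_sum; apply: eq_bigr => v _ /=.
rewrite !linearZ /= -scalerAl -scalerAr scalerA phi_psiX !mcoeffZ !mcoeffX.
rewrite pairm_eq fstmK sndmK mulrACA; congr (_ * _).
by case: (_ == c); case: (_ == b); rewrite ?mul0r ?mul1r ?mulr0.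
Qed.

Definition degsr f : seq 'X_{1..m} := undup [seq sndm s w | w <- msupp f].

Lemma coefl_degsr b f : b \notin degsr f -> coefl b f = 0.
Proof.
move=> nb; apply/mpolyP => a; rewrite mcoeff_coefl mcoeff0.
apply: memN_msupp_eq0; apply: contra nb => w; rewrite mem_undup.
by apply/mapP; exists (pairm s a b); rewrite ?sndmK.
Qed.

Lemma coefl_sumE f : f = \sum_(b <- degsr f) phi (coefl b f) * psi 'X_[b].
Proof.
suff coefE c : coefl c f = coefl c (\sum_(b <- degsr f) phi (coefl b f) * psi 'X_[b]).
  by apply/mpolyP => w; rewrite -(pairmK s w) -!mcoeff_coefl -coefE.
rewrite linear_sum /=.
under eq_bigr => b _ do rewrite coefl_phi_psi mcoeffX.
have [cf | ncf] := boolP (c \in degsr f); last first.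
  rewrite coefl_degsr // big_seq big1 // => b bf.
  by case: eqP => [Eb | _]; [rewrite -Eb bf in ncf | rewrite scale0r].
rewrite (bigD1_seq c) ?undup_uniq //= eqxx scale1r big1 ?addr0 // => b /negbTE ->.
by rewrite scale0r.
Qed.

Lemma coefl_phiM b a f : coefl b (phi a * f) = a * coefl b f.
Proof.
rewrite [in LHS](coefl_sumE f) [in RHS](coefl_sumE f) mulr_sumr !linear_sum mulr_sumr /=.
by apply: eq_bigr => c _; rewrite mulrA -rmorphM /= !coefl_phi_psi scalerAr.
Qed.

Lemma coeflM c f g :
  coefl c (f * g) = \sum_(b <- degsr f) \sum_(b' <- degsr g | (b + b')%MM == c)
    coefl b f * coefl b' g.
Proof.
rewrite {1}(coefl_sumE f) {1}(coefl_sumE g) big_distrlr /= linear_sum.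
apply: eq_bigr => b _; rewrite linear_sum /= [RHS]big_mkcond; apply: eq_bigr => b' _.
rewrite mulrACA -!rmorphM -mpolyXD /= coefl_phi_psi mcoeffX.
by case: eqP; rewrite ?scale0r ?scale1r.
Qed.

(** For an ideal A this is the extended ideal A S, tested coefficient by coefficient. *)
Definition extl A f : Prop := forall b, A (coefl b f).

Lemma extlM A B f g : extl A f -> extl B g -> extl (ideal_mul A B) (f * g).
Proof.
move=> Af Bg c; have ABi := ideal_mul_ideal A B.
rewrite coeflM; apply: ideal_sum => // b _ _; apply: ideal_sum => // b' _ _.
exact: ideal_mul_mem.
Qed.

Lemma extl_ideal A : is_ideal A -> is_ideal (extl A).
Proof.
move=> Ai; have [A0 AD AM] := Ai; split=> [b | f g Af Ag b | f g Ag c].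
- by rewrite raddf0.
- by rewrite raddfD; apply: AD; [apply: Af | apply: Ag].
- rewrite coeflM; apply: ideal_sum => // b _ _; apply: ideal_sum => // b' _ _.
  by apply: AM; apply: Ag.
Qed.

Lemma extl_phi_psi A a t : is_ideal A -> A a -> extl A (phi a * psi t).
Proof.
by case=> _ _ AM Aa b; rewrite coefl_phi_psi -mul_mpolyC; apply: AM.
Qed.

Lemma extl_phi A a : is_ideal A -> A a -> extl A (phi a).
Proof. by move=> Ai Aa; rewrite -[phi a]mulr1 -(rmorph1 psi); apply: extl_phi_psi. Qed.

Lemma ideal_ext_extl A f : is_ideal A -> ideal_ext phi A f -> extl A f.
Proof.
move=> Ai; apply; first exact: extl_ideal.
by move=> _ [a Aa ->]; apply: extl_phi.
Qed.

Lemma extl_proper A : is_proper A -> is_proper (extl A).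
Proof.
move=> A1 /(_ 0%MM); rewrite -[1]mulr1 -{1}(rmorph1 phi) -(rmorph1 psi).
by rewrite coefl_phi_psi mcoeff1 eqxx scale1r.
Qed.

Lemma extl_min A f : ~ extl A f ->
  exists2 b, ~ A (coefl b f) & forall c, (c < b)%O -> A (coefl c f).
Proof.
move=> nAf; apply: NNPP => nomin; apply: nAf.
elim/(@ltmwf m) => b IHb; apply: NNPP => nAb.
by apply: nomin; exists b.
Qed.

(** Any other pair (b, c) with b + c = b0 + c0 has b < b0 or c < c0 in the monomial order, so its
    contribution lies in A. *)
Lemma extl_lead A f g b0 c0 : is_ideal A ->
  (forall b, (b < b0)%O -> A (coefl b f)) ->
  (forall c, (c < c0)%O -> A (coefl c g)) ->
  A (coefl (b0 + c0)%MM (f * g)) -> A (coefl b0 f * coefl c0 g).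
Proof.
move=> Ai Af Ag; have [A0 AD AM] := Ai.
have [b0f | /coefl_degsr -> _] := boolP (b0 \in degsr f); last by rewrite mul0r.
have [c0g | /coefl_degsr -> _] := boolP (c0 \in degsr g); last by rewrite mulr0.
rewrite coeflM (bigD1_seq b0) ?undup_uniq //=.
under eq_bigl => c do rewrite eqm_add2l.
rewrite -big_filter filter_pred1_uniq ?undup_uniq // big_seq1 => Asum.
rewrite -[X in A X](addrK (\sum_(b <- degsr f | b != b0)
  \sum_(c <- degsr g | (b + c)%MM == (b0 + c0)%MM) coefl b f * coefl c g)).
apply: ideal_sub => //; apply: ideal_sum => // b _ ne_b; apply: ideal_sum => // c _.
move/eqP=> bc; case: (ltgtP b b0) => [lt_b | gt_b | eq_b].
- by apply: ideal_mulr => //; apply: Af.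
- apply: AM; apply: Ag; rewrite ltNge; apply/negP => le_c.
  have := ltmc_le_add gt_b le_c; rewrite bc ltxx //.
- by rewrite eq_b eqxx in ne_b.
Qed.

(** As in Gauss's lemma, compare the least exponents at which f and g have a coefficient outside
    A. *)
Lemma extl_prime A : is_prime A -> is_prime (extl A).
Proof.
case=> Ai A1 Ap; split; [exact: extl_ideal | exact: extl_proper |].
move=> f g Afg; apply: NNPP => /not_or_and[/extl_min[b nAb Ab] /extl_min[c nAc Ac]].
by case/Ap: (extl_lead Ai Ab Ac (Afg _)).
Qed.

(** The coefficient of t at its smallest monomial is a nonzero scalar, so it can be cancelled from
    the lowest coefficient of f outside A. *)
Lemma extl_regular A f t : is_ideal A -> t <> 0 -> extl A (f * psi t) -> extl A f.
Proof.
move=> Ai t0 Aft; apply: NNPP => /extl_min[b nAb Ab]; apply: nAb.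
have coefl_psi c : coefl c (psi t) = t@_c *: 1.
  by rewrite -[psi t]mul1r -(rmorph1 phi) coefl_phi_psi.
have tl : t@_(mlast t) != 0 by rewrite -mcoeff_msupp mlast_supp //; apply/eqP.
have At c : (c < mlast t)%O -> A (coefl c (psi t)).
  by move=> lt_c; rewrite coefl_psi mcoeff_lt_mlast // scale0r; case: Ai.
have := extl_lead Ai Ab At (Aft (b + mlast t)%MM).
rewrite coefl_psi -scalerAr mulr1 => Atb.
rewrite -[coefl b f](scalerK tl) -mul_mpolyC.
by case: Ai => _ _; apply.
Qed.

Lemma coefl_pihomog b d f :
  coefl b (pihomog mdeg d f) =
    if (mdeg b <= d)%N then pihomog mdeg (d - mdeg b) (coefl b f) else 0.
Proof.
apply/mpolyP => a; rewrite mcoeff_coefl mcoeff_pihomog mdeg_pairm.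
case: leqP => [le_b | lt_b].
  by rewrite mcoeff_pihomog mcoeff_coefl -[_ == (d - _)%N](eqn_add2r (mdeg b)) subnK.
by rewrite mcoeff0 gtn_eqF // ltn_addl.
Qed.

Lemma coefl_homog b d f : f \is d.-homog -> coefl b f <> 0 ->
  (mdeg b <= d)%N /\ coefl b f \is (d - mdeg b).-homog.
Proof.
move=> fd f0; have := coefl_pihomog b d f; rewrite (pihomog_dE fd).
by case: leqP => // le_b ->; split=> //; apply: pihomogP.
Qed.

Lemma homogeneous_extl A : is_homogeneous A -> is_homogeneous (extl A).
Proof.
case=> Ai Ah; split=> [|f d Af b]; first exact: extl_ideal.
by rewrite coefl_pihomog; case: ifP => _; [apply: Ah | case: Ai].
Qed.

Lemma phi_homog a d : a \is d.-homog -> phi a \is d.-homog.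
Proof.
move=> ad; rewrite (mpolyE a) linear_sum big_seq; apply: rpred_sum => u ua /=.
rewrite linearZ rpredZ //= -[phi _]mulr1 -(rmorph1 psi) -mpolyX0 phi_psiX dhomogX /=.
by rewrite mdeg_pairm mdeg0 addn0 (dhomogP _ _ _ ad).
Qed.

End Splitting.

(** * Products of ideals in disjoint variables *)

Section TwoSided.
Import GRing.Theory.
Local Open Scope ring_scope.
Variables (K : fieldType) (n m N : nat) (s : splitting K n m N).
Local Notation phi := (phi s).
Local Notation psi := (psi s).
Local Notation R := {mpoly K[n]}.
Local Notation T := {mpoly K[m]}.
Local Notation S := {mpoly K[N]}.
Local Notation extr := (extl (swap s)).
Implicit Types (f g h : S) (A I : R -> Prop) (B J : T -> Prop) (L M : S -> Prop).

(** For ideals, the intersection of A S and B S, which is their product because the blocks are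
    disjoint. *)
Definition ext2 A B f : Prop := extl s A f /\ extr B f.

Lemma homogeneous_ext2 A B :
  is_homogeneous A -> is_homogeneous B -> is_homogeneous (ext2 A B).
Proof.
move=> /(homogeneous_extl s) Ah /(homogeneous_extl (swap s)) Bh.
have [[[A0 AD AM] Api] [[B0 BD BM] Bpi]] := (Ah, Bh).
split; first split=> // [f g [Af Bf] [Ag Bg] | f g [Ag Bg]].
- by split; [apply: AD | apply: BD].
- by split; [apply: AM | apply: BM].
- by move=> f d [Af Bf]; split; [apply: Api | apply: Bpi].
Qed.

(* Elimination on the number of tensors: a coefficient of [a] in a first tensor
   [a * t] expresses [t] modulo B through the other right factors. *)
Lemma ext2_min A B M f : is_ideal A -> is_ideal B -> is_ideal M ->
  (forall a t, A a -> B t -> M (phi a * psi t)) -> ext2 A B f -> M f.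
Proof.
move=> Ai Bi Mi MAB [Af Bf]; have [M0 MD _] := Mi; have [_ _ AM] := Ai.
have [_ _ BM] := Bi.
have [r rA fE] : exists2 r : seq (R * T), forall x, x \in r -> A x.1 &
    f = \sum_(x <- r) phi x.1 * psi x.2.
  exists [seq (coefl s b f, 'X_[b]) | b <- degsr s f]; last first.
    by rewrite big_map -coefl_sumE.
  by move=> _ /mapP[b _ ->]; apply: Af.
elim: {r}(size r) {-2}r (erefl (size r)) f rA fE Bf {Af} => [|k IHk] r sz f rA fE Bf.
  by rewrite fE (size0nil sz) big_nil.
case: r sz rA fE => // x r [sz] rA; rewrite big_cons => fE.
have Ax : A x.1 by apply: rA; rewrite mem_head.
have {}rA y : y \in r -> A y.1 by move=> yr; apply: rA; rewrite inE yr orbT.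
have [x0 | x_neq0] := eqVneq x.1 0.
  by apply: (IHk r) => //; rewrite fE x0 rmorph0 mul0r add0r.
set w := mlead x.1; set c := x.1@_w.
have c0 : c != 0 by rewrite mleadc_eq0.
(* This q lies in B, and q / c is [x.2] plus a combination of the other right factors. Subtracting
   [x.1] times q / c from f removes one tensor and keeps all left factors in A. *)
pose q := coefl (swap s) w f.
have coef_q a t : coefl (swap s) w (phi a * psi t) = a@_w *: t.
  by rewrite mulrC (coefl_phi_psi (swap s)).
have qE : q = c *: x.2 + \sum_(y <- r) y.1@_w *: y.2.
  rewrite /q fE raddfD raddf_sum /= coef_q; congr (_ + _).
  by apply: eq_bigr => y _; rewrite coef_q.
have Bq : B (c^-1 *: q) by rewrite -mul_mpolyC; apply: BM; apply: Bf.
rewrite -[f](subrK (phi x.1 * psi (c^-1 *: q))); apply: MD; last exact: MAB.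
apply: (IHk [seq (y.1 - (c^-1 * y.1@_w) *: x.1, y.2) | y <- r]).
- by rewrite size_map.
- move=> _ /mapP[y yr ->] /=; apply: ideal_sub => //; first exact: rA.
  by rewrite -mul_mpolyC; apply: AM.
- rewrite big_map fE qE scalerDr scalerA mulVf // scale1r rmorphD mulrDr.
  rewrite opprD addrACA subrr add0r scaler_sumr rmorph_sum mulr_sumr -sumrB.
  apply: eq_bigr => y _; rewrite /= linearB mulrBl; congr (_ - _).
  by rewrite !linearZ /= -!scalerAr -scalerAl scalerA.
- apply: (ideal_sub (L := extr B)) => //; first exact: extl_ideal.
  by rewrite mulrC; apply: (extl_phi_psi (swap s)).
Qed.

(** One inclusion holds because coefficientwise membership is multiplicative. For the other,
    [ext2_min] reduces to products of an element of I^k and one of J^k, treated by induction on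
    k. *)
Lemma exp_ext2 I J k : is_ideal I -> is_ideal J ->
  ideal_eq (ideal_exp (ideal_mul (ideal_ext phi I) (ideal_ext psi J)) k)
    (ext2 (ideal_exp I k) (ideal_exp J k)).
Proof.
move=> Ii Ji; set IJ := ideal_mul _ _; have IJi : is_ideal IJ := ideal_mul_ideal _ _.
have expi := @ideal_exp_ideal; move=> f; split.
  have IJl g : IJ g -> extl s I g.
    apply: (ideal_mul_min (N := extl s I)); first exact: extl_ideal.
    move=> u v /ideal_ext_extl Iu _.
    by apply: (ideal_mulr (L := extl s I)); [apply: extl_ideal | apply: Iu].
  have IJr g : IJ g -> extr J g.
    apply: (ideal_mul_min (N := extr J)); first exact: extl_ideal.
    move=> u v _ /(@ideal_ext_extl _ _ _ _ (swap s)) Jv.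
    by have [_ _] := extl_ideal (swap s) Ji; apply; apply: Jv.
  elim: k f => [|k IHk] f; first by split.
  apply: (ideal_mul_min (N := ext2 _ _)) => [|u v /[dup] /IJl Iu /IJr Ju /IHk[Iv Jv]].
    have [[L0 LD LM] [R0 RD RM]] :=
      (extl_ideal s (expi _ I k.+1), extl_ideal (swap s) (expi _ J k.+1)).
    split=> // [g h [? ?] [? ?] | g h [? ?]]; first by split; [apply: LD | apply: RD].
    by split; [apply: LM | apply: RM].
  by split; apply: extlM.
apply: ext2_min => // a t; elim: k a t => // k IHk a t Ia Jt.
(* This allows reduction to generators in one factor while the other stays fixed. *)
have mulM (A : comNzRingType) (F : {rmorphism A -> S}) (L : S -> Prop) c :
    is_ideal L -> is_ideal (fun x => L (F x * c)).
  case=> L0 LD LM; split=> [|x y Lx Ly|x y Ly].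
  - by rewrite rmorph0 mul0r.
  - by rewrite rmorphD mulrDl; apply: LD.
  - by rewrite rmorphM -mulrA; apply: LM.
apply: (ideal_mul_min (N := fun x => ideal_exp IJ k.+1 (phi x * psi t))) Ia.
  exact: mulM.
move=> a1 a2 Ia1 Ia2; rewrite mulrC.
apply: (ideal_mul_min (N := fun x => ideal_exp IJ k.+1 (psi x * phi (a1 * a2)))) Jt.
  exact: mulM.
move=> t1 t2 Jt1 Jt2; rewrite mulrC !rmorphM mulrACA.
apply: ideal_mul_mem; last exact: IHk.
apply: ideal_mul_mem => L _; apply; first by exists a1.
by exists t1.
Qed.

(** If a is a monomial of [coefl s b f], then b is a monomial of the coefficient of f at a in the
    first block, which lies in B. *)
Lemma ext2_degree_ge B e f :
  (forall t, B t -> degree_ge e t) -> extr B f ->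
  forall b, coefl s b f <> 0 -> (e <= mdeg b)%N.
Proof.
move=> Be Bf b fb0; pose a := mlead (coefl s b f).
apply: (Be _ (Bf a)); rewrite mcoeff_msupp mcoeff_coefl /= -mcoeff_coefl.
by rewrite mleadc_eq0; apply/eqP.
Qed.

(* Any nonzero [a] in A satisfies [a f \in B S], and is regular modulo [B S]. *)
Lemma ext2_prime_lower A B L f d e : is_ideal A -> is_ideal B -> is_nonzero A ->
  (forall t, B t -> degree_ge e t) -> ideal_eq L (ext2 A B) ->
  f \is d.-homog -> is_prime (ideal_colon L f) ->
  (forall g, extl s A (g * f) -> L (g * f)) ->
  exists2 d', prime_colon_degree A d' & (d' + e <= d)%N.
Proof.
move=> Ai Bi [a Aa a0] Be LAB fd fP AL; have [A0 AD AM] := Ai.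
have Bf : extr B f.
  apply: (extl_regular Bi a0).
  suff /LAB[_] : L (phi a * f) by rewrite mulrC.
  apply: AL; apply: (ideal_mulr (L := extl s A)).
    exact: extl_ideal.
  exact: extl_phi.
(* The contraction of (L : f) to R is prime. *)
have pi_prime : is_prime (fun r => L (phi r * f)).
  case: fP => [[P0 PD PM] P1 Pp]; split.
  - split=> [|x y Lx Ly|x y Ly]; first by rewrite rmorph0.
      by rewrite rmorphD; apply: PD.
    by rewrite rmorphM; apply: PM.
  - by rewrite /is_proper rmorph1.
  - by move=> x y; rewrite rmorphM => /Pp.
have [b _ bP] : exists2 b, b \in degsr s f &
    forall r, ideal_colon A (coefl s b f) r -> L (phi r * f).
  apply: (prime_bigcap pi_prime) => [b | r rA]; first exact: ideal_colon_ideal.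
  apply: AL => b; rewrite coefl_phiM.
  have [bf | /coefl_degsr ->] := boolP (b \in degsr s f); first exact: rA.
  by rewrite mulr0.
have fb0 : coefl s b f <> 0.
  case: pi_prime => _ P1 _ fb0; apply: P1; apply: bP.
  by rewrite /ideal_colon fb0 mulr0.
have [le_b fb_homog] := coefl_homog fd fb0.
exists (d - mdeg b)%N; last first.
  by have := ext2_degree_ge Be Bf fb0; lia.
(* The contraction also lies in (A : f_b), since L lies in A S. *)
exists (coefl s b f) => //; apply: is_prime_eq pi_prime => r; split; last exact: bP.
by move=> /LAB[/(_ b) Ar _]; rewrite /ideal_colon -coefl_phiM.
Qed.

(** For t in B nonzero of degree e, (L : f t) is the extension of (A : f): membership in B S is
    automatic, and t is regular modulo A S. *)
Lemma ext2_prime_upper A B L d e : is_ideal A -> is_ideal B -> min_degree B e ->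
  ideal_eq L (ext2 A B) -> prime_colon_degree A d -> prime_colon_degree L (d + e).
Proof.
move=> Ai Bi [[t [te Bt t0]] _] LAB [f fd fP].
exists (phi f * psi t).
  by apply: dhomogM; [apply: phi_homog | apply: (phi_homog (swap s))].
apply: is_prime_eq (extl_prime s fP) => g.
split=> [gP | /LAB[]].
  apply/LAB; split.
    rewrite mulrA; apply: (ideal_mulr (L := extl s A)); first exact: extl_ideal.
    by move=> b; rewrite mulrC coefl_phiM mulrC; apply: gP.
  rewrite mulrA; have [_ _] := extl_ideal (swap s) Bi; apply.
  exact: (extl_phi (swap s)).
rewrite mulrA => /(extl_regular Ai t0) gfA _ b.
by rewrite /ideal_colon mulrC -coefl_phiM mulrC.
Qed.

End TwoSided.

(** * The concrete splitting of the variables into x and y *)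

Section TwoBlocks.
Import GRing.Theory.
Local Open Scope ring_scope.
Variables (K : fieldType) (n m : nat).

Definition xy_pair (a : 'X_{1..n}) (b : 'X_{1..m}) : 'X_{1..n + m} :=
  [multinom match split i with inl j => a j | inr j => b j end | i < n + m].
Definition xy_fst (w : 'X_{1..n + m}) : 'X_{1..n} := [multinom w (lshift m i) | i < n].
Definition xy_snd (w : 'X_{1..n + m}) : 'X_{1..m} := [multinom w (rshift n i) | i < m].

Lemma xy_pair_lshift a b i : xy_pair a b (lshift m i) = a i.
Proof. by rewrite mnmE (unsplitK (inl i)). Qed.

Lemma xy_pair_rshift a b i : xy_pair a b (rshift n i) = b i.
Proof. by rewrite mnmE (unsplitK (inr i)). Qed.

Lemma xy_pairK w : xy_pair (xy_fst w) (xy_snd w) = w.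
Proof.
by apply/mnmP => i; rewrite -(splitK i); case: (split i) => j /=;
  rewrite ?xy_pair_lshift ?xy_pair_rshift mnmE.
Qed.

Lemma xy_fstK a b : xy_fst (xy_pair a b) = a.
Proof. by apply/mnmP => i; rewrite mnmE xy_pair_lshift. Qed.

Lemma xy_sndK a b : xy_snd (xy_pair a b) = b.
Proof. by apply/mnmP => i; rewrite mnmE xy_pair_rshift. Qed.

Lemma mdeg_xy_pair a b : mdeg (xy_pair a b) = (mdeg a + mdeg b)%N.
Proof.
rewrite !mdegE big_split_ord /=; congr addn; apply: eq_bigr => i _.
  exact: xy_pair_lshift.
exact: xy_pair_rshift.
Qed.

Lemma xy_phi_psiX a b :
  comp_mpoly [tuple 'X_(lshift m i) | i < n] 'X_[a] *
  comp_mpoly [tuple 'X_(rshift n j) | j < m] 'X_[b] =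
  'X_[xy_pair a b] :> {mpoly K[n + m]}.
Proof.
rewrite !comp_mpolyX [RHS]mpolyXE_id big_split_ord /=.
by congr (_ * _); apply: eq_bigr => i _;
  rewrite tnth_mktuple ?xy_pair_lshift ?xy_pair_rshift.
Qed.

(** The inferred morphisms are convertible to [inclx] and [incly], so [exp_ext2] applies to the
    ideals of the theorem. *)
Definition xy_splitting : splitting K n m (n + m) :=
  @Splitting K n m (n + m) xy_pair xy_fst xy_snd xy_pairK xy_fstK xy_sndK
    mdeg_xy_pair _ _ xy_phi_psiX.

End TwoBlocks.

Theorem corollary2p3 (K : fieldType) (n m : nat)
    (I : {mpoly K[n]} -> Prop) (J : {mpoly K[m]} -> Prop)
    (I_homog : is_homogeneous I) (I_proper : is_proper I)
    (I_neq0 : is_nonzero I)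
    (J_homog : is_homogeneous J) (J_proper : is_proper J)
    (J_neq0 : is_nonzero J) :
  let IS := ideal_ext (@inclx K n m) I in
  let JS := ideal_ext (@incly K n m) J in
  exists k0 : nat, forall k : nat, (k0 <= k)%N ->
    vnum (ideal_exp (ideal_mul IS JS) k) =
      minn (vnum (ideal_exp I k) + initial_degree J * k)
           (vnum (ideal_exp J k) + initial_degree I * k).
Proof.
(* Positivity of k makes the powers of I and J proper. *)
move=> IS JS; exists 1%N => k k_gt0; pose s := xy_splitting K n m.
have [[Ii _] [Ji _]] := (I_homog, J_homog).
have LAB := exp_ext2 s k Ii Ji : ideal_eq (ideal_exp (ideal_mul IS JS) k) _.
set L := ideal_exp (ideal_mul IS JS) k in LAB *.
have Ah := homogeneous_exp k I_homog; have Bh := homogeneous_exp k J_homog.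
have A1 := ideal_exp_proper Ii I_proper k_gt0.
have B1 := ideal_exp_proper Ji J_proper k_gt0.
have mA := min_degree_exp k (min_degree_initial I_homog I_neq0).
have mB := min_degree_exp k (min_degree_initial J_homog J_neq0).
move: (ideal_exp I k) (ideal_exp J k) Ah Bh A1 B1 mA mB LAB => A B Ah Bh A1 B1 mA mB LAB.
move: (initial_degree I * k)%N (initial_degree J * k)%N mA mB => a b mA mB.
have [[Ai _] [Bi _]] := (Ah, Bh).
(* With the blocks exchanged, the same bounds give the other term of the minimum. *)
have LBA : ideal_eq L (ext2 (swap s) B A).
  by move=> f; split=> [/LAB[Af Bf] | [Bf Af]]; [split | apply/LAB; split].
have Lh : is_homogeneous L.
  have [[M0 MD MM] Mpi] := homogeneous_ext2 s Ah Bh.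
  split; first split.
  - exact/LAB.
  - by move=> f g /LAB Lf /LAB Lg; apply/LAB; apply: MD.
  - by move=> f g /LAB Lg; apply/LAB; apply: MM.
  - by move=> f d /LAB Lf; apply/LAB; apply: Mpi.
have L1 : is_proper L by move=> /LAB[/(extl_proper A1)].
have [vL vLmin] := vnumP Lh L1; have [vA vAmin] := vnumP Ah A1.
have [vB vBmin] := vnumP Bh B1.
apply/eqP; rewrite eqn_leq leq_min -andbA; apply/and3P; split.
- by apply: vLmin; apply: (ext2_prime_upper Ai Bi mB LAB vA).
- by apply: vLmin; apply: (ext2_prime_upper Bi Ai mA LBA vB).
case: vL => f fd fP.
have nzA : is_nonzero A by case: mA => [[c [_ Ac c0]] _]; exists c.
have nzB : is_nonzero B by case: mB => [[c [_ Bc c0]] _]; exists c.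
(* The prime (L : f) is the intersection of these two colons, so it contains one of them. *)
pose Q i := if i then ideal_colon (extl s A) f else ideal_colon (extl (swap s) B) f.
have [|g Qg|[] _ QP] := @prime_bigcap _ bool _ [:: true; false] Q fP.
- by case; apply: ideal_colon_ideal; apply: extl_ideal.
- by apply/LAB; split; [apply: (Qg true) | apply: (Qg false)].
- have [d' /vAmin le_d' le_d] := ext2_prime_lower Ai Bi nzA mB.2 LAB fd fP QP.
  by rewrite geq_min; apply/orP; left; lia.
- have [d' /vBmin le_d' le_d] := ext2_prime_lower Bi Ai nzB mA.2 LBA fd fP QP.
  by rewrite geq_min; apply/orP; right; lia.
Qed.
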